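(* Let $p\ge 5$ be a prime, $m\ge 1$ an integer, and $q=p^m$ with $q\equiv 2\pmod 3$. Then the cubic AGM graph $G_{\mathrm{AGM}}$ over $\mathbb{F}_q$ is a disjoint union of directed cycles.
   Context: Since $q\equiv 2\pmod 3$, every element of $\mathbb{F}_q$ has a unique cube root in $\mathbb{F}_q$. The cubic AGM graph $G_{\mathrm{AGM}}$ over $\mathbb{F}_q$ is the directed graph with vertex set $V_{\mathrm{AGM}}=\{(u,v)\in\mathbb{F}_q^2\mid v\ne 0,\ u^3\ne v^3\}$ and with a directed edge $(u,v)\to(u',v')$ between vertices exactly when $u'=\frac{u+2v}{3}$ and $v'^3=\frac{v(u^2+uv+v^2)}{3}$. Each vertex has exactly one outgoing edge. Loops count as directed cycles of length $1$. *)

(* Defs.v *)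
From HB Require Import structures.
From mathcomp Require Import all_boot all_order all_algebra.

Set Implicit Arguments.
Unset Strict Implicit.
Unset Printing Implicit Defensive.

Import GRing.Theory.
Local Open Scope ring_scope.

(* A digraph with vertex type T and adjacency relation e is a disjoint union   *)
(* of directed cycles when its vertices can be listed, each exactly once, in   *)
(* nonempty cycles whose arcs are exactly the arcs of the digraph. The cycle   *)
(* [:: x_1; ...; x_k] has the arcs x_i -> x_(i+1) and x_k -> x_1; in           *)
(* particular [:: x] is the loop x -> x, as next [:: x] x = x.                 *)
Definition disjoint_union_of_dicycles (T : finType) (e : rel T) : Prop :=
  exists cs : seq (seq T),
    [/\ [::] \notin cs,
        uniq (flatten cs),
        forall x : T, x \in flatten cs
      & forall x y : T,
          e x y <-> exists2 c, c \in cs & x \in c /\ y = next c x].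

Definition AGM_vertex_pred (F : finFieldType) : pred (F * F) :=
  fun w => (w.2 != 0) && (w.1 ^+ 3 != w.2 ^+ 3).

Definition AGM_vertex (F : finFieldType) : finType :=
  {w : F * F | AGM_vertex_pred w}.

Definition AGM_edge (F : finFieldType) : rel (AGM_vertex F) :=
  fun x y =>
    let: (u, v) := val x in
    let: (u', v') := val y in
    (u' == (u + 2%:R * v) / 3%:R) &&
    (v' ^+ 3 == v * (u ^+ 2 + u * v + v ^+ 2) / 3%:R).
Arguments AGM_edge : clear implicits.

(* Main.v *)
(* The cube map on F_q is a bijection because x ^ (2q - 1) = x and 3 divides
   2q - 1, so the edges of the graph are those of a self-map of the vertices.
   That self-map is injective: since u'^3 - v'^3 = ((u - v) / 3)^3, the target
   (u', v') determines u - v, and with u + 2v = 3u' it determines u and v.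
   Finally, an injective self-map of a finite set splits it into cyclic
   orbits. *)
Require Import Defs.
From HB Require Import structures.
From mathcomp Require Import all_boot all_order all_algebra.
From mathcomp Require Import fingroup cyclic finfield ring.

Set Implicit Arguments.
Unset Strict Implicit.
Unset Printing Implicit Defensive.

Import GRing.Theory.

Section Orbits.

Variables (T : finType) (f : T -> T).
Hypothesis f_inj : injective f.

Lemma orbits_uniq : uniq (flatten [seq orbit f x | x <- enum (froots f)]).
Proof.
(* In this form duplicate-freeness reduces to recovering the root from any point of its orbit. *)
rewrite (_ : flatten _ = [seq y | x <- enum (froots f), y <- orbit f x]);
  last by congr flatten; apply: eq_map => x; rewrite map_id.
apply: (@allpairs_uniq_dep _ (fun=> T) T (fun x y => y)).
- exact: enum_uniq.
- by move=> x _; exact: orbit_uniq.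
move=> _ _ /allpairsPdep[x [y [xr xy ->]]] /allpairsPdep[x' [y' [xr' xy' ->]]] /= E.
rewrite -{}E in xy' *.
move: xr xr' xy xy'; rewrite !mem_enum -!fconnect_orbit => /eqP xr /eqP xr' xy xy'.
(* Injectivity makes reachability symmetric, so both roots equal the root of the shared point. *)
have fsym := fconnect_sym f_inj.
by rewrite -xr -xr' (fingraph.rootP fsym xy) (fingraph.rootP fsym xy').
Qed.

Lemma mem_orbits x : x \in flatten [seq orbit f x | x <- enum (froots f)].
Proof.
have fsym := fconnect_sym f_inj.
apply/flattenP; exists (orbit f (froot f x)).
  by apply: map_f; rewrite mem_enum; exact: roots_root.
by rewrite -fconnect_orbit fsym; exact: connect_root.
Qed.

Lemma next_orbit x y : y \in orbit f x -> next (orbit f x) y = f y.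
Proof. by move=> yx; apply/esym/eqP; exact: next_cycle (cycle_orbit f_inj x) yx. Qed.

(** The cycles are the orbits of the chosen roots; as [f] is injective, each orbit closes up and
    [next] is [f] along it. *)
Lemma inj_disjoint_union_of_dicycles (e : rel T) :
  (forall x y, e x y <-> y = f x) -> disjoint_union_of_dicycles e.
Proof.
move=> eE; exists [seq orbit f x | x <- enum (froots f)]; split.
- by apply/mapP=> -[x _] E; have := in_orbit f x; rewrite -E.
- exact: orbits_uniq.
- exact: mem_orbits.
move=> x y; split=> [/eE ->|[_ /mapP[r _ ->] [xr ->]]].
  have /flattenP[c cs xc] := mem_orbits x; exists c => //; split=> //.
  by case/mapP: cs xc => r _ -> xr; rewrite next_orbit.
by apply/eE; exact: next_orbit.
Qed.

End Orbits.

Local Open Scope ring_scope.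

Section CubicAGM.

Variable F : finFieldType.
Hypothesis cardF : #|F| = 2 %[mod 3].

Let k := (#|F| %/ 3)%N.
Let card_eq : #|F| = (k * 3 + 2)%N.
Proof. by rewrite {1}(divn_eq #|F| 3) cardF. Qed.

(** The order of the additive group kills 1, so 3k + 2 = 0 in [F]; were 3 = 0, then 2 = 0 and 1 = 3
    - 2 = 0. *)
Lemma natr3_neq0 : 3%:R != 0 :> F.
Proof.
apply/eqP=> F3; have : #|F|%:R = 0 :> F.
  by have := expg_cardG (in_setT (1 : F)); rewrite cardsT FinRing.zmodXgE.
rewrite card_eq natrD natrM F3 mulr0 add0r => F2.
have /eqP[] := oner_neq0 F; rewrite -(subrr (2%:R : F)) {1}F2 sub0r.
by rewrite -[RHS]add0r -F3; ring: F2.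
Qed.

(** With q = 3k + 2 the exponent is (2q - 1)/3, an inverse of 3 modulo q - 1. *)
Definition cbrt (z : F) := z ^+ (2 * k + 1).

Lemma exp3K : cancel (fun x : F => x ^+ 3) cbrt.
Proof.
move=> x; rewrite /cbrt -exprM.
(* This form of x^q = x also covers x = 0; it is applied twice below, as the exponent is 2(q - 1) +
   1. *)
have xq1 : x * x ^+ (k * 3 + 1) = x by rewrite -exprS -addnS -card_eq expf_card.
rewrite (_ : 3 * (2 * k + 1) = (k * 3 + 1) + (k * 3 + 1).+1)%N; last ring.
by rewrite exprD exprS xq1 mulrC xq1.
Qed.

Lemma cbrtK : cancel cbrt (fun x : F => x ^+ 3).
Proof. by move=> x; rewrite -[RHS]exp3K /cbrt -!exprM mulnC. Qed.

Definition AGM_map (w : F * F) : F * F :=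
  ((w.1 + 2%:R * w.2) / 3%:R,
   cbrt (w.2 * (w.1 ^+ 2 + w.1 * w.2 + w.2 ^+ 2) / 3%:R)).

(** Multiplied by 27, this is (u + 2v)^3 - 9v(u^2 + uv + v^2) = (u - v)^3. *)
Lemma AGM_map_subX3 w :
  (AGM_map w).1 ^+ 3 - (AGM_map w).2 ^+ 3 = ((w.1 - w.2) / 3%:R) ^+ 3.
Proof. by rewrite /= cbrtK; field; exact: natr3_neq0. Qed.

Lemma AGM_map_inj : injective AGM_map.
Proof.
move=> w w' E.
have /(can_inj exp3K) D : ((w.1 - w.2) / 3%:R) ^+ 3 = ((w'.1 - w'.2) / 3%:R) ^+ 3.
  by rewrite -!AGM_map_subX3 E.
have [A _] := E.
have F3 := natr3_neq0.
(* [snd_eq] and [fst_eq] invert the linear change of coordinates to (u + 2v)/3 and (u - v)/3, which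
   [A] and [D] show to agree. *)
have snd_eq (z : F * F) : z.2 = (z.1 + 2%:R * z.2) / 3%:R - (z.1 - z.2) / 3%:R.
  by field; exact: F3.
have fst_eq (z : F * F) :
    z.1 = (z.1 + 2%:R * z.2) / 3%:R + 2%:R * ((z.1 - z.2) / 3%:R).
  by field; exact: F3.
rewrite [w]surjective_pairing [w']surjective_pairing.
by congr pair; [rewrite fst_eq A D -fst_eq | rewrite snd_eq A D -snd_eq].
Qed.

(** Both factors of u^3 - v^3 are nonzero: the quadratic one, with v, gives v' != 0, and u - v gives
    u'^3 != v'^3. *)
Lemma AGM_map_vertex w : AGM_vertex_pred w -> AGM_vertex_pred (AGM_map w).
Proof.
case/andP=> v0 uv3.
have : (w.1 - w.2) * (w.1 ^+ 2 + w.1 * w.2 + w.2 ^+ 2) != 0.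
  by rewrite (_ : _ * _ = w.1 ^+ 3 - w.2 ^+ 3) ?subr_eq0 //; ring.
rewrite mulf_eq0 negb_or => /andP[uv0 s0]; apply/andP; split.
  have : (AGM_map w).2 ^+ 3 != 0.
    by rewrite cbrtK !mulf_neq0 // invr_neq0 // natr3_neq0.
  by rewrite expf_eq0.
by rewrite -subr_eq0 AGM_map_subX3 expf_neq0 // mulf_neq0 // invr_neq0 // natr3_neq0.
Qed.

Definition AGM_next (x : AGM_vertex F) : AGM_vertex F :=
  Sub (AGM_map (val x)) (AGM_map_vertex (valP x)).

Lemma AGM_next_inj : injective AGM_next.
Proof. by move=> x y /(congr1 val) /AGM_map_inj /val_inj. Qed.

Lemma AGM_edgeE x y : AGM_edge F x y <-> y = AGM_next x.
Proof.
have -> : (y = AGM_next x) <-> (val y = AGM_map (val x)).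
  by split=> [->//|E]; exact: val_inj.
rewrite /AGM_edge; case: (val x) (val y) => [u v] [u' v'] /=; split.
  by case/andP=> /eqP -> /eqP E; rewrite /AGM_map -E exp3K.
by case=> -> ->; rewrite cbrtK !eqxx.
Qed.

End CubicAGM.

Local Close Scope ring_scope.

Theorem corollary3p3 (p m q : nat) (F : finFieldType)
    (p_prime : prime p) (p_ge5 : 5 <= p) (m_ge1 : 1 <= m)
    (q_def : q = p ^ m) (q_mod3 : q = 2 %[mod 3]) (cardF : #|F| = q) :
  disjoint_union_of_dicycles (AGM_edge F).
Proof.
have q3 : #|F| = 2 %[mod 3] by rewrite cardF.
exact: (inj_disjoint_union_of_dicycles (@AGM_next_inj F q3) (AGM_edgeE q3)).
Qed.
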